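(* Let $0<\alpha\leq 1$. If $\varphi$ is a real non-constant function on $\mathbb T$ and $\varphi\in C^{1,\alpha}(\mathbb T)$, then for all $p$ with $1\leq p<1+\alpha$ there is a constant $c_p>0$, independent of $\lambda$, such that $$\|e^{i\lambda\varphi}\|_{A_p(\mathbb T)}\geq c_p\,|\lambda|^{\frac1p-\frac1{1+\alpha}},\qquad \lambda\in\mathbb R.$$ In particular, $\|e^{i\lambda\varphi}\|_{A(\mathbb T)}\geq c\,|\lambda|^{\frac{\alpha}{1+\alpha}}$ for all $\lambda\in\mathbb R$, with some $c>0$ independent of $\lambda$.
   Context: $\mathbb T=\mathbb R/2\pi\mathbb Z$; functions on $\mathbb T$ are identified with $2\pi$-periodic functions on $\mathbb R$. Fourier coefficients: $\widehat f(k)=\frac1{2\pi}\int_0^{2\pi}f(t)e^{-ikt}\,dt$, $k\in\mathbb Z$. $A_1(\mathbb T)=A(\mathbb T)$ is the space of continuous functions $f$ on $\mathbb T$ with $\{\widehat f(k)\}\in l^1$; for $1<p\le 2$, $A_p(\mathbb T)$ is the space of integrable functions $f$ on $\mathbb T$ with $\{\widehat f(k)\}\in l^p$. The norm is $\|f\|_{A_p(\mathbb T)}=\big(\sum_{k\in\mathbb Z}|\widehat f(k)|^p\big)^{1/p}$. $C^{1,\alpha}(\mathbb T)$ is the class of $2\pi$-periodic differentiable functions $g$ on $\mathbb R$ whose derivative satisfies the Lipschitz (Hölder) condition of order $\alpha$: $\sup_{|t_1-t_2|\le\delta}|g'(t_1)-g'(t_2)|=O(\delta^\alpha)$ as $\delta\to+0$.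 *)

(* Defs.v *)
From mathcomp Require Import all_boot all_order all_algebra.
From mathcomp Require Import all_classical all_reals all_analysis.
From mathcomp.real_closed Require Import complex.
Import Order.TTheory GRing.Theory Num.Theory.
Import numFieldNormedType.Exports.

Set Implicit Arguments.
Unset Strict Implicit.
Unset Printing Implicit Defensive.

Local Open Scope classical_set_scope.
Local Open Scope ring_scope.

(* Functions on the circle R / 2 pi Z are represented throughout by 2 pi-periodic
   functions on R. *)

(* e^{i x} for real x. *)
Definition expi {R : realType} (x : R) : R[i] := (cos x +i* sin x)%C.

(* The library has no integral of complex-valued functions: integrate the real
   and imaginary parts separately. *)
Definition cintegral {R : realType} (D : set R) (f : R -> R[i]) : R[i] :=
  ((\int[lebesgue_measure]_(t in D) complex.Re (f t))
   +i* (\int[lebesgue_measure]_(t in D) complex.Im (f t)))%C.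

Definition fourier_coef {R : realType} (f : R -> R[i]) (k : int) : R[i] :=
  ((2 * pi)^-1)%:C%C *
  cintegral `[0, 2 * pi] (fun t => f t * expi (- (k%:~R * t))).

(* The norm is taken in the extended reals, with value +oo when the coefficients
   are not p-summable.  [normc] is the real-valued modulus: the generic norm
   `|z| of z : R[i] is again an element of R[i]. *)
Definition A_norm {R : realType} (p : R) (f : R -> R[i]) : \bar R :=
  ((\esum_(k in [set: int])
      (ComplexField.Normc.normc (fourier_coef f k) `^ p)%:E) `^ (p^-1))%E.

Definition modulus_of_continuity {R : realType} (g : R -> R) (delta : R) : \bar R :=
  ereal_sup [set (`|g t.1 - g t.2|)%:E | t in [set t : R * R | `|t.1 - t.2| <= delta]].

(* O(delta ^ alpha) as delta -> 0+, stated for the extended-real modulus of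
   continuity: a real-valued supremum would be 0 on unbounded sets. *)
Definition hoelder_cond {R : realType} (alpha : R) (g : R -> R) : Prop :=
  exists C : R, \forall delta \near 0^'+,
    (modulus_of_continuity g delta <= (C * delta `^ alpha)%:E)%E.

Definition C1_alpha {R : realType} (alpha : R) (g : R -> R) : Prop :=
  [/\ periodic g (2 * pi),
      forall x, derivable g x 1
    & hoelder_cond alpha (derive1 g)].

(* Main.v *)
Require Import Defs.
From mathcomp Require Import all_boot all_order all_algebra.
From mathcomp Require Import all_classical all_reals all_analysis.
From mathcomp Require Import ring lra.
From mathcomp.real_closed Require Import complex.
Import Order.TTheory GRing.Theory Num.Theory.
Import numFieldNormedType.Exports.
Local Open Scope classical_set_scope.
Local Open Scope ring_scope.

(** On an arc of length delta about t0 the phase phi differs from its tangent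
line by O(delta^(1+alpha)), so for delta of the order |lambda|^(-1/(1+alpha))
the function e^(i lambda phi) looks there like a character of frequency
lambda phi'(t0).  If this frequency is an integer k, the k-th Fourier
coefficient of e^(i lambda phi) times a hump of width delta at t0 is therefore
at least a constant times delta: no cancellation takes place.

A non-constant periodic phi has a zero of phi' and a point where phi' is
positive; phi' is continuous, so it takes all values of some interval [0, b].
Hence at least b |lambda| integers k can be reached in this way, each with its
own hump (derive1_range).

Multiplication by the hump averages Fourier coefficients.  With the hump
((1 + cos (t - t0)) / 2)^n, whose width is of the order n^(-1/2), the averaging
is explicit: one factor replaces the coefficient c_k by
c_k / 2 + (e^(i t0) c_(k+1) + e^(-i t0) c_(k-1)) / 4.  In modulus it is
dominated by the averaging operator lattice_avg, which does not depend on t0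
(hump_coefS, le_hump_coef).  So a single sequence, the
n-fold average of the moduli of the Fourier coefficients, is at least a
constant times delta at all the b |lambda| integers at once, and averaging does
not increase l^p norms for p >= 1 (esum_powR_iter_lattice_avg).  This gives

  norm of e^(i lambda phi) in A_p >= c |lambda|^(1/p) |lambda|^(-1/(1+alpha)).

What remains is quantitative.  The mass of the hump satisfies an exact
recurrence, which yields both its lower bound pi / sqrt n (hump_mass_lower) and
its second moment (hump_coef_lower); the latter absorbs the error of the tangent
line (cos_phase_lower, hump_coef_large). *)

(** * Averaging on the integer lattice *)

(** This is convolution with the Fourier coefficients 1/4, 1/2, 1/4 of
(1 + cos t) / 2. *)
Definition lattice_avg {R : realType} (a : int -> R) (k : int) : R :=
  a k / 2 + (a (k - 1) / 4 + a (k + 1) / 4).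

Lemma lattice_avg_ge0 {R : realType} (a : int -> R) :
  (forall k, 0 <= a k) -> forall k, 0 <= lattice_avg a k.
Proof. by move=> a0 k; rewrite /lattice_avg !addr_ge0 ?divr_ge0. Qed.

Lemma iter_lattice_avg_ge0 {R : realType} (a : int -> R) n :
  (forall k, 0 <= a k) -> forall k, 0 <= iter n lattice_avg a k.
Proof. by move=> a0; elim: n => //= n IH; exact: lattice_avg_ge0. Qed.

Lemma powR_half_convex {R : realType} (p x y : R) : 1 <= p -> 0 <= x -> 0 <= y ->
  ((x + y) / 2) `^ p <= (x `^ p + y `^ p) / 2.
Proof.
move=> p1 x0 y0.
have h0 : 0 <= (2^-1 : R) by lra.
have h1 : (2^-1 : R) <= 1 by lra.
have -> : (x + y) / 2 = 2^-1 * x + (1 - 2^-1) * y by lra.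
have -> : (x `^ p + y `^ p) / 2 = 2^-1 * x `^ p + (1 - 2^-1) * y `^ p by lra.
by apply: (convex_powR p1 (Itv01 h0 h1)) => //=; rewrite ?inE/= ?in_itv/= ?andbT.
Qed.

(** Jensen's inequality for the weights 1/2, 1/4, 1/4, as two midpoint averages. *)
Lemma powR_lattice_avg {R : realType} (p : R) (a : int -> R) k : 1 <= p ->
  (forall k, 0 <= a k) -> lattice_avg a k `^ p <= lattice_avg (fun j => a j `^ p) k.
Proof.
move=> p1 a0; rewrite /lattice_avg.
have -> : a k / 2 + (a (k - 1) / 4 + a (k + 1) / 4) =
          (a k + (a (k - 1) + a (k + 1)) / 2) / 2 by field.
apply: le_trans (powR_half_convex _ _ _ p1 (a0 k) _) _.
  by rewrite divr_ge0// addr_ge0.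
have := powR_half_convex p _ _ p1 (a0 (k - 1)) (a0 (k + 1)).
by lra.
Qed.

Lemma esum_shift {R : realType} (a : int -> \bar R) (m : int) :
  (\esum_(k in [set: int]) a (k + m)%R = \esum_(k in [set: int]) a k)%E.
Proof.
symmetry; apply: (reindex_esum setT setT (fun k : int => k + m) a); split => //.
- by move=> x y _ _ /addIr.
- by move=> x _; exists (x - m) => //=; rewrite subrK.
Qed.

Lemma esum_lattice_avg {R : realType} (a : int -> R) : (forall k, 0 <= a k) ->
  (\esum_(k in [set: int]) (lattice_avg a k)%:E = \esum_(k in [set: int]) (a k)%:E)%E.
Proof.
move=> a0.
have q0 d k : 0 < d -> (0 <= (a k / d)%:E)%E.
  by move=> d0; rewrite lee_fin divr_ge0// ltW.
rewrite /lattice_avg.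
under eq_esum do rewrite 2!EFinD.
rewrite !esumD; try by move=> *; rewrite ?adde_ge0// q0.
rewrite (esum_shift (fun k => (a k / 4)%:E) (-1)) (esum_shift (fun k => (a k / 4)%:E) 1).
rewrite -!esumD; try by move=> *; rewrite ?adde_ge0// q0.
by apply: eq_esum => k _; rewrite -!EFinD; congr EFin; field.
Qed.

(** Convolution with a probability vector contracts l^p: apply Jensen at each
point, then shift invariance of the sum. *)
Lemma esum_powR_iter_lattice_avg {R : realType} (p : R) (a : int -> R) n : 1 <= p ->
  (forall k, 0 <= a k) ->
  (\esum_(k in [set: int]) (iter n lattice_avg a k `^ p)%:E <=
   \esum_(k in [set: int]) (a k `^ p)%:E)%E.
Proof.
move=> p1 a0; elim: n => //= n; apply: le_trans.
have b0 := iter_lattice_avg_ge0 a n a0.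
rewrite -(esum_lattice_avg (fun k => iter n lattice_avg a k `^ p)); last first.
  by move=> k; exact: powR_ge0.
by apply: le_esum => k _; rewrite lee_fin; exact: powR_lattice_avg.
Qed.

Lemma esum_ge_injective {R : realType} {T : choiceType} (b : T -> R) (f : nat -> T)
    (N : nat) (c : R) :
  0 <= c -> injective f -> (forall j, (j < N)%N -> c <= b (f j)) ->
  ((N%:R * c)%:E <= \esum_(x in [set: T]) (b x)%:E)%E.
Proof.
move=> c0 finj cb.
apply: (@le_trans _ _ (\esum_(x in f @` `I_N) (b x)%:E)%E); last first.
  by apply: ereal_sup_le => _ [X [finX XI] <-]; exists X => //; split.
have finj' : set_inj `I_N f.
  by move=> x y _ _; exact: finj.
rewrite (esum_image `I_N f) //.
apply: (@le_trans _ _ (\esum_(j in `I_N) c%:E)%E); last first.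
  by apply: le_esum => j jN; rewrite lee_fin cb.
rewrite esum_fset//.
by rewrite -(@fsbig_ord _ _ _ N (fun=> c%:E)) sumEFin sumr_const card_ord mulr_natl.
Qed.

(** * Fourier coefficients localized by a hump *)

Definition circle_int {R : realType} (f : R -> R) : R :=
  \int[lebesgue_measure]_(t in `[0, 2 * pi]) f t.

Lemma integrable_circle {R : realType} (f : R -> R) : continuous f ->
  (@lebesgue_measure R).-integrable `[0, 2 * pi] (EFin \o f).
Proof.
move=> cf; apply: continuous_compact_integrable; first exact: segment_compact.
exact: continuous_subspaceT.
Qed.

Lemma circle_intD {R : realType} (f g : R -> R) : continuous f -> continuous g ->
  circle_int (fun t => f t + g t) = circle_int f + circle_int g.
Proof. by move=> cf cg; apply: RintegralD => //; exact: integrable_circle. Qed.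

Lemma circle_intZ {R : realType} (r : R) (f : R -> R) : continuous f ->
  circle_int (fun t => r * f t) = r * circle_int f.
Proof. by move=> cf; apply: RintegralZl => //; exact: integrable_circle. Qed.

Lemma eq_circle_int {R : realType} (f g : R -> R) : f =1 g ->
  circle_int f = circle_int g.
Proof. by move=> fg; apply: eq_Rintegral => t _; exact: fg. Qed.

Lemma le_circle_int {R : realType} (f g : R -> R) : continuous f -> continuous g ->
  (forall t, f t <= g t) -> circle_int f <= circle_int g.
Proof. by move=> cf cg fg; apply: le_Rintegral => //; exact: integrable_circle. Qed.

Lemma circle_int_cst {R : realType} (c : R) : circle_int (fun=> c) = c * (2 * pi).
Proof.
have E : lebesgue_measure (`[0, 2 * pi]%classic : set R) = (2 * pi)%:E.
  by rewrite lebesgue_measure_itv/= lte_fin mulr_gt0 ?pi_gt0//= oppr0 adde0.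
by rewrite /circle_int Rintegral_cst// [X in fine X]E.
Qed.

Lemma circle_int_derive {R : realType} (F f : R -> R) : continuous f ->
  (forall t : R, is_derive t 1 F (f t)) -> F (2 * pi) = F 0 -> circle_int f = 0.
Proof.
move=> cf dF F0.
have cF : continuous F.
  by move=> t; apply: differentiable_continuous; apply/derivable1_diffP.
rewrite /circle_int /Rintegral (@continuous_FTC2 _ _ F).
- by rewrite F0 subee.
- by rewrite mulr_gt0 ?pi_gt0.
- exact: continuous_subspaceT.
- split.
  + by move=> t _; have := dF t.
  + exact/cvg_at_right_filter/cF.
  + exact/cvg_at_left_filter/cF.
- by move=> t _; rewrite derive1E; have := dF t => ?; rewrite derive_val.
Qed.

(** The powers of this function serve as localizers instead of a compactly
supported bump because they are trigonometric polynomials with non-negative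
coefficients: every Fourier expansion below is a finite identity. *)
Definition hump {R : realType} (x : R) : R := (1 + cos x) / 2.

Lemma hump_ge0 {R : realType} (x : R) : 0 <= hump x.
Proof. by rewrite /hump; have := cos_geN1 x; lra. Qed.

Lemma continuous_humpX {R : realType} (t0 : R) n :
  continuous (fun t => hump (t - t0) ^+ n).
Proof.
move=> t; apply: (@continuous_comp _ _ _ (fun t => hump (t - t0)) (fun x => x ^+ n)).
  apply: cvgM; last exact: cvg_cst.
  apply: cvgD; first exact: cvg_cst.
  apply: (continuous_comp (f := fun t => t - t0)); last exact: continuous_cos.
  by apply: cvgB; [exact: cvg_id|exact: cvg_cst].
exact: exprn_continuous.
Qed.

Lemma continuous_phase {R : realType} (psi : R -> R) (w th : R) : continuous psi ->
  continuous (fun t => psi t - w * t - th).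
Proof.
move=> cpsi t; apply: cvgB; last exact: cvg_cst.
apply: cvgB; first exact: cpsi.
by apply: cvgM; [exact: cvg_cst|exact: cvg_id].
Qed.

Lemma continuous_cos_comp {R : realType} (f : R -> R) : continuous f ->
  continuous (fun t => cos (f t)).
Proof. by move=> cf t; apply: continuous_comp; [exact: cf|exact: continuous_cos]. Qed.

(** Real part of e^(-i th) times the unnormalized k-th Fourier coefficient of
hump (t - t0)^n e^(i psi(t)).  Bounding it for all th is bounding the modulus of
that coefficient, so no complex integral has to be manipulated. *)
Definition hump_coef {R : realType} (psi : R -> R) (t0 : R) (n : nat) (k : int) (th : R) :=
  circle_int (fun t => hump (t - t0) ^+ n * cos (psi t - k%:~R * t - th)).

(** Product-to-sum formula for cos (t - t0) cos (psi t - k t - th): the centre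
t0 enters only through the rotation th, hence disappears from moduli. *)
Lemma hump_coefS {R : realType} (psi : R -> R) (t0 : R) n k th : continuous psi ->
  hump_coef psi t0 n.+1 k th = hump_coef psi t0 n k th / 2 +
    (hump_coef psi t0 n (k - 1) (th + t0) / 4 +
     hump_coef psi t0 n (k + 1) (th - t0) / 4).
Proof.
move=> cpsi.
have cB j s : continuous (fun t => hump (t - t0) ^+ n * cos (psi t - j%:~R * t - s)).
  move=> t; apply: cvgM; first exact: continuous_humpX.
  by apply: (continuous_cos_comp (fun t => psi t - j%:~R * t - s)); exact: continuous_phase.
have cBZ j s (r : R) : continuous (fun t => r * (hump (t - t0) ^+ n * cos (psi t - j%:~R * t - s))).
  by move=> t; apply: cvgM; [exact: cvg_cst|exact: cB].
rewrite /hump_coef ![_ / 2]mulrC ![_ / 4]mulrC -!circle_intZ//.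
rewrite -!circle_intD//; last first.
  by move=> t; apply: cvgD; exact: cBZ.
apply: eq_circle_int => t.
rewrite intrB intrD.
have -> : psi t - (k%:~R - 1%:~R) * t - (th + t0) =
          (psi t - k%:~R * t - th) + (t - t0) by ring.
have -> : psi t - (k%:~R + 1%:~R) * t - (th - t0) =
          (psi t - k%:~R * t - th) - (t - t0) by ring.
move: (psi t - k%:~R * t - th) (t - t0) => x y.
by rewrite cosB cosD exprS {1}/hump; field.
Qed.

(** The majorant on the right is the same for all centres t0; this is what allows
a different hump for each frequency. *)
Lemma le_hump_coef {R : realType} (psi : R -> R) (a : int -> R) (M t0 : R) n :
  continuous psi -> (forall k th, hump_coef psi t0 0 k th <= M * a k) ->
  forall k th, hump_coef psi t0 n k th <= M * iter n lattice_avg a k.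
Proof.
move=> cpsi H; elim: n => [//|n IH] k th.
rewrite hump_coefS//= /lattice_avg.
have := IH k th; have := IH (k - 1) (th + t0); have := IH (k + 1) (th - t0).
lra.
Qed.

Lemma cos_sin_comb_le {R : realType} (x y th : R) :
  cos th * x + sin th * y <= Num.sqrt (x ^+ 2 + y ^+ 2).
Proof.
have [h|h] := lerP (cos th * x + sin th * y) 0.
  exact: (le_trans h (sqrtr_ge0 _)).
rewrite -(ler_sqr (ltW h) (sqrtr_ge0 _)) sqr_sqrtr ?addr_ge0 ?sqr_ge0//.
have := cos2Dsin2 th; set c := cos th; set s := sin th => cs.
rewrite -subr_ge0 (_ : _ - _ = (s * x - c * y) ^+ 2) ?sqr_ge0//.
have -> : x ^+ 2 + y ^+ 2 = (c ^+ 2 + s ^+ 2) * (x ^+ 2 + y ^+ 2) by rewrite cs mul1r.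
by ring.
Qed.

(** With no hump, hump_coef is the scalar product of the unit vector
(cos th, sin th) with the real and imaginary parts of the Fourier coefficient. *)
Lemma hump_coef0 {R : realType} (psi : R -> R) (t0 : R) k th : continuous psi ->
  hump_coef psi t0 0 k th <=
  2 * pi * ComplexField.Normc.normc (fourier_coef (fun t => expi (psi t)) k).
Proof.
move=> cpsi.
rewrite /fourier_coef ComplexField.Normc.normcM /cintegral /=.
rewrite expr0n /= addr0 sqrtr_sqr gtr0_norm ?invr_gt0 ?mulr_gt0 ?pi_gt0//.
rewrite mulrA divff ?mul1r; last by rewrite mulf_neq0 ?gt_eqF ?pi_gt0.
have cs : continuous (fun t : R => sin (psi t - k%:~R * t)).
  move=> t; apply: continuous_comp; last exact: continuous_sin.
  by apply: cvgB; [exact: cpsi|apply: cvgM; [exact: cvg_cst|exact: cvg_id]].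
have cc : continuous (fun t : R => cos (psi t - k%:~R * t)).
  apply: continuous_cos_comp => t.
  by apply: cvgB; [exact: cpsi|apply: cvgM; [exact: cvg_cst|exact: cvg_id]].
apply: le_trans (cos_sin_comb_le _ _ th).
rewrite (_ : hump_coef _ _ _ _ _ = cos th * circle_int (fun t => cos (psi t - k%:~R * t)) +
   sin th * circle_int (fun t => sin (psi t - k%:~R * t))); last first.
  rewrite -!circle_intZ// -circle_intD; last 2 first.
  - by move=> t; apply: cvgM; [exact: cvg_cst|exact: cc].
  - by move=> t; apply: cvgM; [exact: cvg_cst|exact: cs].
  by apply: eq_circle_int => t; rewrite expr0 mul1r cosB; ring.
rewrite le_eqVlt; apply/orP; left; apply/eqP; congr (_ * _ + _ * _);
  apply: eq_circle_int => t /=.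
- by rewrite cosD.
- by rewrite sinD; ring.
Qed.

(** * The mass and the second moment of the hump *)

Lemma is_derive_hump {R : realType} (x : R) : is_derive x 1 hump (- sin x / 2).
Proof.
have -> : hump = 2^-1 \*: (cst 1 + cos) :> (R -> R).
  by apply/funext => y; rewrite /hump /= mulrC.
by apply: is_derive_eq; rewrite add0r /GRing.scale /= mulrC.
Qed.

Definition hump_mass {R : realType} (t0 : R) (n : nat) : R :=
  circle_int (fun t => hump (t - t0) ^+ n).

(** The difference of the two sides is the integral over a period of the
derivative of sin (t - t0) hump (t - t0)^n, as sin^2 = (1 - cos) (1 + cos). *)
Lemma hump_mass_step {R : realType} (t0 : R) n :
  (2 * n%:R + 2) * hump_mass t0 n.+1 = (2 * n%:R + 1) * hump_mass t0 n.
Proof.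
rewrite /hump_mass.
apply/eqP; rewrite -subr_eq0; apply/eqP.
have cX m := continuous_humpX t0 m.
have cZ (r : R) m : continuous (fun t => r * hump (t - t0) ^+ m).
  by move=> t; apply: cvgM; [exact: cvg_cst|exact: cX].
rewrite -mulNr -!circle_intZ// -circle_intD//.
apply: (circle_int_derive (fun t => sin (t - t0) * hump (t - t0) ^+ n)).
- by move=> t; apply: cvgD; exact: cZ.
- move=> t.
  have dsh : is_derive t 1 (shift (- t0)) 1 := is_derive_shift _ _ _.
  have ds : is_derive t 1 (sin \o shift (- t0)) (cos (t - t0) * 1).
    exact: is_derive1_comp.
  have db : is_derive t 1 (hump \o shift (- t0)) (- sin (t - t0) / 2 * 1).
    apply: is_derive1_comp; exact: is_derive_hump.
  have -> : (fun t : R => sin (t - t0) * hump (t - t0) ^+ n) =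
      (sin \o shift (- t0)) * (hump \o shift (- t0)) ^+ n.
    by apply/funext => x; rewrite fctE exprfctE.
  apply: is_derive_eq.
  rewrite exprfctE /= !mulr1 /GRing.scale /=.
  have s2 := sin2cos2 (t - t0).
  case: n {cX cZ} => [|m] /=; first by rewrite !expr0 /hump; field.
  rewrite [in RHS]exprS.
  have -> : sin (t - t0) * (m.+1%:R * hump (t - t0) ^+ m * (- sin (t - t0) / 2)) =
    - m.+1%:R * hump (t - t0) ^+ m * (sin (t - t0) ^+ 2 / 2) by field.
  rewrite s2 [hump _ ^+ m.+1]exprS; set B := hump (t - t0) ^+ m.
  by rewrite /hump; field.
- have e x : 2 * pi + x = x + pi *+ 2 :> R by rewrite mulr_natl addrC.
  by rewrite e add0r /hump sinD2pi cosD2pi.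
Qed.

Lemma hump_mass0 {R : realType} (t0 : R) : hump_mass t0 0 = 2 * pi.
Proof.
by rewrite /hump_mass (eq_circle_int _ (fun=> 1)) ?circle_int_cst ?mul1r.
Qed.

Lemma hump_massS {R : realType} (t0 : R) n :
  hump_mass t0 n.+1 = hump_mass t0 n * ((2 * n%:R + 1) / (2 * n%:R + 2)).
Proof.
have h := hump_mass_step t0 n.
have n0 : 0 <= n%:R :> R by [].
rewrite mulrA; apply: (canRL (mulfK _)); first by apply/eqP; lra.
by rewrite mulrC h mulrC.
Qed.

Lemma hump_mass_ge0 {R : realType} (t0 : R) n : 0 <= hump_mass t0 n.
Proof. by apply: Rintegral_ge0 => t _; rewrite exprn_ge0 ?hump_ge0. Qed.

(** By the recurrence, n times the square of the n-th mass is nondecreasing in n,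
and it equals pi^2 at n = 1. *)
Lemma hump_mass_lower {R : realType} (t0 : R) n :
  pi / Num.sqrt n.+1%:R <= hump_mass t0 n.+1.
Proof.
have sq : pi ^+ 2 <= n.+1%:R * hump_mass t0 n.+1 ^+ 2.
  elim: n => [|n IH].
    rewrite hump_massS hump_mass0 mul1r mulr0 !add0r.
    by rewrite (_ : 2 * pi * (1 / 2) = pi)//; field.
  apply: le_trans IH _; rewrite (hump_massS t0 n.+1) exprMn [leRHS]mulrCA [leLHS]mulrC.
  rewrite ler_wpM2l ?sqr_ge0//.
  have n0 : 0 <= n%:R :> R by [].
  by rewrite expr_div_n mulrA ler_pdivlMr ?exprn_gt0// -natr1; lra.
have s0 : 0 < Num.sqrt n.+1%:R :> R by rewrite sqrtr_gt0.
rewrite ler_pdivrMr// -ler_sqr ?nnegrE ?mulr_ge0 ?hump_mass_ge0 ?pi_ge0 ?(ltW s0)//.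
by rewrite exprMn sqr_sqrtr// [leRHS]mulrC.
Qed.

(** Since 1 - cos = 2 (1 - hump), the recurrence makes the integral of
8 n (1 - cos (t - t0)) hump (t - t0)^n equal to 16 n / (2 n + 2) <= 8 times the mass;
the constant 9 is 1 + 8. *)
Lemma hump_coef_lower {R : realType} (psi : R -> R) (t0 th E : R) n k :
  continuous psi -> 0 <= E ->
  (forall t, 1 - E * (1 + 8 * n%:R * (1 - cos (t - t0))) <=
             cos (psi t - k%:~R * t - th)) ->
  (1 - 9 * E) * hump_mass t0 n <= hump_coef psi t0 n k th.
Proof.
move=> cpsi E0 H.
have n0 : 0 <= n%:R :> R by [].
have cX m := continuous_humpX t0 m.
have cZ (r : R) m : continuous (fun t => r * hump (t - t0) ^+ m).
  by move=> t; apply: cvgM; [exact: cvg_cst|exact: cX].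
pose A : R := 1 - E * (1 + 16 * n%:R); pose B : R := E * (16 * n%:R).
apply: (@le_trans _ _ (circle_int
   (fun t => A * hump (t - t0) ^+ n + B * hump (t - t0) ^+ n.+1))).
  rewrite circle_intD// !circle_intZ// -!/(hump_mass _ _) hump_massS.
  rewrite -subr_ge0.
  rewrite (_ : _ - _ = hump_mass t0 n * E * (16 / (2 * n%:R + 2))); last first.
    by rewrite /A /B; field; apply/eqP; lra.
  by rewrite !mulr_ge0 ?hump_mass_ge0 ?invr_ge0 ?addr_ge0 ?mulr_ge0.
apply: le_circle_int.
- by move=> t; apply: cvgD; exact: cZ.
- move=> t; apply: cvgM; first exact: cX.
  apply: (continuous_cos_comp (fun t => psi t - k%:~R * t - th)).
  exact: continuous_phase.
move=> t; rewrite exprS.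
rewrite (_ : _ + _ = hump (t - t0) ^+ n * (1 - E * (1 + 8 * n%:R * (1 - cos (t - t0))))).
  by rewrite ler_wpM2l ?exprn_ge0 ?hump_ge0.
by rewrite /A /B /hump; field.
Qed.

(** * Elementary bounds for the cosine *)

Lemma cos_ge_1_sub_norm {R : realType} (x : R) : 1 - `|x| <= cos x.
Proof.
rewrite -cos_norm.
have [|c _] := @MVT_segment R cos (fun x => - sin x) 0 _ (normr_ge0 x).
  exact/continuous_subspaceT/continuous_cos.
rewrite cos0 subr0 => e.
have := ler_wpM2r (normr_ge0 x) (sin_le1 c); lra.
Qed.

Lemma sqr_le_8_1_sub_cos {R : realType} (x : R) : `|x| <= pi ->
  x ^+ 2 <= 8 * (1 - cos x).
Proof.
move=> xpi; rewrite -cos_norm -real_normK ?num_real//.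
move: (normr_ge0 x) xpi; move: `|x| => {}x x0 xpi.
(* 1 - cos x = 8 cos^2 (x/4) sin^2 (x/4), where x/4 <= pi/4 keeps the squared
   cosines above 1/2, and sin (x/4) = cos c * (x/4) by the mean value theorem. *)
have hc (c : R) : 0 <= c <= pi / 4 -> 1 / 2 <= cos c ^+ 2.
  move=> /andP[c0 c1].
  have := cos_mulr2n c; have : 0 <= cos (c *+ 2); last by rewrite mulr2n; lra.
  have p0 := @pi_ge0 R.
  by apply: cos_ge0_pihalf; rewrite -mulr_natl; apply/andP; split; lra.
pose y := x / 4.
have y0 : 0 <= y by rewrite /y; lra.
have ypi : y <= pi / 4 by rewrite /y; lra.
have [|c + e] := @MVT_segment R sin cos 0 y y0.
  exact/continuous_subspaceT/continuous_sin.
rewrite in_itv/= => /andP[c0 cy].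
have e2 : sin y ^+ 2 = cos c ^+ 2 * y ^+ 2.
  by rewrite -exprMn -[y in RHS]subr0 -e sin0 subr0.
have -> : x = y *+ 2 *+ 2 by rewrite !mulr2n /y; field.
have -> : cos (y *+ 2 *+ 2) = 1 - 8 * (cos y ^+ 2 * sin y ^+ 2).
  by rewrite cos_mulr2n cos_mulr2n sin2cos2 mulr2n; ring.
have hy := hc y; have hcc := hc c.
have h1 : 1 / 2 <= cos y ^+ 2 by apply: hy; rewrite y0.
have h2 : 1 / 2 <= cos c ^+ 2 by apply: hcc; rewrite c0; lra.
rewrite e2 (_ : (y *+ 2 *+ 2) ^+ 2 = 16 * y ^+ 2); last by rewrite !mulr2n; ring.
have := sqr_ge0 y; move: (y ^+ 2) => z z0.
have : 1 / 2 * (1 / 2) <= cos y ^+ 2 * cos c ^+ 2 by rewrite ler_pM.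
move/(ler_wpM2r z0); lra.
Qed.

Lemma periodicz {R : realType} (f : R -> R) (T : R) (m : int) t : periodic f T ->
  f (t + m%:~R * T) = f t.
Proof.
move=> pf; case: m => m.
  by rewrite -pmulrn mulr_natl periodicn.
by rewrite NegzE intrN mulNr -(periodicn pf m.+1 (t - _)) -pmulrn mulr_natl subrK.
Qed.

Lemma cos_periodicz {R : realType} (m : int) (t : R) : cos (t + m%:~R * (2 * pi)) = cos t.
Proof. by apply: periodicz; rewrite mulr_natl; exact: cosD2pi. Qed.

Lemma ex_period_shift_le_pi {R : realType} (y : R) : exists m : int, `|y + m%:~R * (2 * pi)| <= pi.
Proof.
have p0 := @pi_gt0 R.
exists (- Num.floor ((y + pi) / (2 * pi))).
have := floor_itv ((y + pi) / (2 * pi)).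
set m := Num.floor _ => /andP[h1 h2].
rewrite ler_pdivlMr ?mulr_gt0// in h1.
rewrite ltr_pdivrMr ?mulr_gt0// intrD mulrDl in h2.
rewrite intrN mulNr ler_norml; lra.
Qed.

(** * Phases with a Hoelder continuous derivative *)

Lemma hoelder_local {R : realType} (alpha : R) (g : R -> R) : 0 < alpha ->
  hoelder_cond alpha g ->
  exists C d : R, [/\ 0 <= C, 0 < d &
    forall s t, `|s - t| < d -> `|g s - g t| <= C * `|s - t| `^ alpha].
Proof.
move=> a0 [C]; rewrite near_withinE => /nbhs_ballP[d /= d0 H].
exists (Num.max C 0), d; split; rewrite ?le_max ?lexx ?orbT// => s t std.
have [->|st] := eqVneq s t.
  by rewrite !subrr normr0 mulr_ge0 ?powR_ge0// le_max lexx orbT.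
have st0 : 0 < `|s - t| by rewrite normr_gt0 subr_eq0.
apply: (@le_trans _ _ (C * `|s - t| `^ alpha)); last first.
  by rewrite ler_wpM2r ?powR_ge0// le_max lexx.
rewrite -lee_fin; apply: le_trans (H `|s - t| _ st0).
  by apply: ereal_sup_ubound; exists (s, t) => /=.
by rewrite /ball/= sub0r normrN normr_id.
Qed.

(** Distances up to pi suffice on a circle of length 2 pi. *)
Definition hoelder_upto_pi {R : realType} (alpha C : R) (g : R -> R) : Prop :=
  forall s t, `|s - t| <= pi -> `|g s - g t| <= C * `|s - t| `^ alpha.

(** Chaining: the modulus of continuity is controlled only at small scales, so a
longer step is cut into a fixed number of small ones. *)
Lemma hoelder_pi {R : realType} (alpha : R) (g : R -> R) : 0 < alpha ->
  hoelder_cond alpha g ->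
  exists2 C : R, 0 <= C & hoelder_upto_pi alpha C g.
Proof.
move=> a0 /(hoelder_local _ _ a0)[C [d [C0 d0 H]]].
have chain m s h : `|h| < d -> `|g (s + m%:R * h) - g s| <= m%:R * (C * `|h| `^ alpha).
  move=> hd; elim: m => [|m IH]; first by rewrite !mul0r addr0 subrr normr0.
  have e : s + m.+1%:R * h - (s + m%:R * h) = h by rewrite -natr1; ring.
  have := H (s + m.+1%:R * h) (s + m%:R * h); rewrite e => /(_ hd) h1.
  rewrite (_ : g _ - g s = (g (s + m.+1%:R * h) - g (s + m%:R * h)) +
     (g (s + m%:R * h) - g s)); last by ring.
  by apply: le_trans (ler_normD _ _) _; rewrite -[in leRHS]natr1 mulrDl mul1r; lra.
have q0 : 0 < pi / d :> R by rewrite divr_gt0 ?pi_gt0.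
have := archi_boundP (ltW q0); set M := Num.bound _ => qM.
have M0 : 0 < M%:R :> R by apply: lt_trans qM.
exists (M%:R * C) => [|s t st]; first by rewrite mulr_ge0 ?(ltW M0).
pose h := (s - t) / M%:R.
have hle : `|h| <= `|s - t|.
  rewrite /h normf_div (gtr0_norm M0) ler_pdivrMr// ler_peMr//.
  by move: M0; rewrite ltr0n ler1n.
have hd : `|h| < d.
  rewrite /h normf_div (gtr0_norm M0) ltr_pdivrMr//; apply: le_lt_trans st _.
  by rewrite mulrC -ltr_pdivrMr.
have := chain M t h hd.
rewrite (_ : t + M%:R * h = s); last first.
  by rewrite /h mulrC divfK ?gt_eqF// addrC subrK.
move=> /le_trans; apply; rewrite -mulrA ler_wpM2l ?(ltW M0)// ler_wpM2l//.
by rewrite ge0_ler_powR ?nnegrE// ltW.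
Qed.

Lemma hoelder_continuous {R : realType} (alpha : R) (g : R -> R) : 0 < alpha ->
  hoelder_cond alpha g -> continuous g.
Proof.
move=> a0 /(hoelder_local _ _ a0)[C [d [C0 d0 H]]] t.
apply/cvgrPdist_le => e e0.
have C1 : 0 < C + 1 by lra.
pose r := (e / (C + 1)) `^ alpha^-1.
have r0 : 0 < r by rewrite powR_gt0// divr_gt0.
near=> x.
have xd : `|t - x| < d by near: x; exact: cvgr_dist_lt.
have xr : `|t - x| < r by near: x; exact: cvgr_dist_lt.
apply: le_trans (H _ _ xd) _.
apply: (@le_trans _ _ ((C + 1) * r `^ alpha)).
  apply: ler_pM; rewrite ?powR_ge0//; first by lra.
  by rewrite ge0_ler_powR ?nnegrE// ltW.
rewrite /r -powRrM mulVf ?gt_eqF// powRr1 ?divr_ge0 ?(ltW e0) ?(ltW C1)//.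
by rewrite [leLHS]mulrC divfK ?gt_eqF.
Unshelve. all: by end_near. Qed.

Lemma mean_value {R : realType} (phi : R -> R) (a b : R) :
  (forall x, derivable phi x 1) ->
  exists2 c, `|c - a| <= `|b - a| & phi b - phi a = derive1 phi c * (b - a).
Proof.
move=> dphi.
have cphi : continuous phi.
  by move=> t; apply: differentiable_continuous; apply/derivable1_diffP.
have dd (x : R) : is_derive x 1 phi (derive1 phi x).
  by rewrite derive1E; exact: derivableP.
have [ab|ba] := leP a b.
  have [|c] := @MVT_segment R phi (derive1 phi) a b ab (fun x _ => dd x).
    exact: continuous_subspaceT.
  rewrite in_itv/= => /andP[ac cb] e; exists c => //.
  by rewrite !ger0_norm ?subr_ge0//; lra.
have [|c] := @MVT_segment R phi (derive1 phi) b a (ltW ba) (fun x _ => dd x).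
  exact: continuous_subspaceT.
rewrite in_itv/= => /andP[bc ca] e; exists c => //.
  by rewrite !ler0_norm ?subr_le0 ?(ltW ba)//; lra.
by rewrite -[LHS]opprB e; ring.
Qed.

Lemma taylor_hoelder {R : realType} (alpha C : R) (phi : R -> R) (a b : R) : 0 < alpha ->
  (forall x, derivable phi x 1) -> 0 <= C ->
  hoelder_upto_pi alpha C (derive1 phi) ->
  `|b - a| <= pi ->
  `|phi b - phi a - derive1 phi a * (b - a)| <= C * (`|b - a| `^ alpha * `|b - a|).
Proof.
move=> a0 dphi C0 H ba.
have [c cab ->] := mean_value phi a b dphi.
rewrite -mulrBl normrM mulrA ler_wpM2r//.
apply: le_trans (H c a (le_trans cab ba)) _.
by rewrite ler_wpM2l// ge0_ler_powR ?nnegrE// ltW.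
Qed.

(** For y = s x this is y^(1+alpha) <= 1 + y^2.  It trades the Hoelder exponent for
a second moment, which for the hump is explicit. *)
Lemma powR_mul_le_sqr {R : realType} (alpha s x : R) : 0 < alpha -> alpha <= 1 ->
  0 < s -> 0 <= x -> x `^ alpha * x <= (s `^ alpha * s)^-1 * (1 + s ^+ 2 * x ^+ 2).
Proof.
move=> a0 a1 s0 x0.
have D0 : 0 < s `^ alpha * s by rewrite mulr_gt0 ?powR_gt0.
rewrite [leRHS]mulrC ler_pdivlMr//.
rewrite (_ : _ * _ * _ = (s * x) `^ alpha * (s * x)); last first.
  by rewrite powRM ?(ltW s0)//; ring.
rewrite -exprMn.
have : 0 <= s * x by rewrite mulr_ge0 ?(ltW s0).
move: (s * x) => y y0.
have [y1|y1] := leP y 1.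
  have : y `^ alpha <= 1.
    by have := @ge0_ler_powR _ _ (ltW a0) y 1; rewrite !nnegrE powR1; apply.
  move=> /(ler_wpM2r y0); rewrite mul1r => /le_trans; apply.
  have := sqr_ge0 y; lra.
have : y `^ alpha <= y by rewrite ler1_powR// ltW.
by move=> /(ler_wpM2r y0) /le_trans; apply; rewrite expr2 lerDr.
Qed.

(** The frequency k is an integer, so the phase lambda phi t - k t is a function on the
circle modulo 2 pi; t may be moved by a period to within pi of t0, where the
tangent line cancels against k t and leaves the error
|lambda| C |x|^(1+alpha). *)
Lemma cos_phase_lower {R : realType} (alpha C lambda s : R) (phi : R -> R) (t0 t : R)
    (k : int) :
  0 < alpha -> alpha <= 1 -> 0 <= C -> periodic phi (2 * pi) ->
  (forall x, derivable phi x 1) ->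
  hoelder_upto_pi alpha C (derive1 phi) ->
  lambda * derive1 phi t0 = k%:~R -> 0 < s ->
  1 - `|lambda| * C / (s `^ alpha * s) * (1 + 8 * s ^+ 2 * (1 - cos (t - t0))) <=
  cos (lambda * phi t - k%:~R * t - (lambda * phi t0 - k%:~R * t0)).
Proof.
move=> a0 a1 C0 pphi dphi H lk s0.
have [m xpi] := ex_period_shift_le_pi (t - t0).
rewrite -(cos_periodicz m (t - t0)).
set x := t - t0 + m%:~R * (2 * pi) in xpi *.
pose r := phi (t0 + x) - phi t0 - derive1 phi t0 * x.
have -> : lambda * phi t - k%:~R * t - (lambda * phi t0 - k%:~R * t0) =
          lambda * r + (k * m)%:~R * (2 * pi).
  have -> : phi t = phi (t0 + x).
    by rewrite /x addrA addrCA subrr addr0 periodicz.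
  by rewrite intrM -lk /r /x; ring.
rewrite (cos_periodicz (k * m)); apply: le_trans (cos_ge_1_sub_norm _).
rewrite lerD2l lerN2 normrM -!mulrA ler_wpM2l//.
have hr : `|r| <= C * (`|x| `^ alpha * `|x|).
  have := taylor_hoelder alpha C phi t0 (t0 + x) a0 dphi C0 H.
  by rewrite addrAC subrr add0r; apply.
apply: le_trans hr _; rewrite ler_wpM2l//.
apply: le_trans (powR_mul_le_sqr alpha s _ a0 a1 s0 (normr_ge0 x)) _.
rewrite ler_wpM2l ?invr_ge0 ?mulr_ge0 ?powR_ge0 ?(ltW s0)// lerD2l.
have := sqr_le_8_1_sub_cos x xpi; rewrite real_normK ?num_real//.
by move/(ler_wpM2l (sqr_ge0 s)); lra.
Qed.

(** By periodicity the point with the larger value can be put to the right of the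
one with the smaller value, so phi' is positive somewhere; over a full period it
vanishes somewhere. *)
Lemma derive1_range {R : realType} (phi : R -> R) : periodic phi (2 * pi) ->
  (forall x, derivable phi x 1) -> continuous (derive1 phi) ->
  (exists s t : R, phi s <> phi t) ->
  exists2 b : R, 0 < b & forall y, 0 <= y <= b -> exists t, derive1 phi t = y.
Proof.
move=> pphi dphi cphi' [s [t st]].
have {s t st} [s [t st]] : exists s t, phi s < phi t.
  have /orP[h|h] : (phi s < phi t) || (phi t < phi s).
  - by rewrite -neq_lt; apply/eqP.
  - by exists s, t.
  - by exists t, s.
have tp : 0 < 2 * pi :> R by rewrite mulr_gt0 ?pi_gt0.
have [t' t's et] : exists2 t', s < t' & phi t' = phi t.
  pose m := Num.bound (`|s - t| / (2 * pi)).
  have : `|s - t| / (2 * pi) < m%:R by apply: archi_boundP; rewrite divr_ge0// ltW.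
  rewrite ltr_pdivrMr// => hm.
  exists (t + (m : int)%:~R * (2 * pi)); last exact: periodicz.
  by have := ler_norm (s - t); rewrite -pmulrn; lra.
have dd (x : R) : is_derive x 1 phi (derive1 phi x).
  by rewrite derive1E; exact: derivableP.
have cphi : continuous phi.
  by move=> x; apply: differentiable_continuous; apply/derivable1_diffP.
have [|u _ eu] := MVT t's (fun x _ => dd x); first exact: continuous_subspaceT.
have [|v _ ev] := MVT tp (fun x _ => dd x); first exact: continuous_subspaceT.
have v0 : derive1 phi v = 0.
  move/eqP: ev; rewrite -[2 * pi]add0r pphi subrr eq_sym mulf_eq0 subr0 add0r.
  by rewrite (gt_eqF tp) orbF => /eqP.
have u0 : 0 < derive1 phi u.
  by have : 0 < phi t' - phi s; [rewrite et subr_gt0|rewrite eu pmulr_lgt0 ?subr_gt0].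
exists (derive1 phi u) => // y /andP[y0 yu].
have [vu|uv] := leP v u.
- have [||c _ <-] := @IVT R (derive1 phi) v u y vu; last by exists c.
    exact: continuous_subspaceT.
  by rewrite v0 ge_min le_max y0 yu !orbT.
- have [||c _ <-] := @IVT R (derive1 phi) u v y (ltW uv); last by exists c.
    exact: continuous_subspaceT.
  by rewrite v0 ge_min le_max y0 yu !orbT.
Qed.

(** * Lower bounds for the norm *)

(** The hump of exponent n + 1 has width 1 / s.  The hypothesis on s says that the
phase error |lambda| C s^(-(1+alpha)) on that scale is at most 1/18, which loses
at most half of the mass. *)
Lemma hump_coef_large {R : realType} (alpha C lambda : R) (phi : R -> R) (t0 : R)
    (k : int) n (s := Num.sqrt n.+1%:R) :
  0 < alpha -> alpha <= 1 -> 0 <= C -> periodic phi (2 * pi) ->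
  (forall x, derivable phi x 1) ->
  hoelder_upto_pi alpha C (derive1 phi) ->
  lambda * derive1 phi t0 = k%:~R ->
  18 * (`|lambda| * C) <= s `^ alpha * s ->
  2^-1 * (pi / s) <=
    hump_coef (fun t => lambda * phi t) t0 n.+1 k (lambda * phi t0 - k%:~R * t0).
Proof.
move=> a0 a1 C0 pphi dphi H lk hs.
have s0 : 0 < s by rewrite sqrtr_gt0.
have s2 : s ^+ 2 = n.+1%:R by rewrite sqr_sqrtr.
have D0 : 0 < s `^ alpha * s by rewrite mulr_gt0 ?powR_gt0.
have cphi : continuous (fun t => lambda * phi t).
  move=> t; apply: cvgM; first exact: cvg_cst.
  by apply: differentiable_continuous; apply/derivable1_diffP.
pose E := `|lambda| * C / (s `^ alpha * s).
have E0 : 0 <= E by rewrite divr_ge0 ?mulr_ge0 ?powR_ge0 ?(ltW s0).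
have E1 : 18 * E <= 1 by rewrite /E mulrA ler_pdivrMr// mul1r.
apply: le_trans (hump_coef_lower (fun t => lambda * phi t) t0 _ E n.+1 k cphi E0 _).
  apply: ler_pM => //; [by rewrite divr_ge0 ?pi_ge0 ?(ltW s0)|by lra|].
  exact: hump_mass_lower.
move=> t; rewrite -s2; exact: cos_phase_lower.
Qed.

(** The integers 0, ..., N, with the sign of lambda, are all of the form
lambda phi'(t0), and at each of them the averaged moduli are at least 1 / (4 s). *)
Lemma A_norm_lower {R : realType} (alpha C b p lambda : R) (phi : R -> R) (n N : nat)
    (s := Num.sqrt n.+1%:R) :
  0 < alpha -> alpha <= 1 -> 0 <= C -> periodic phi (2 * pi) ->
  (forall x, derivable phi x 1) ->
  hoelder_upto_pi alpha C (derive1 phi) ->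
  (forall y, 0 <= y <= b -> exists t, derive1 phi t = y) ->
  1 <= p ->
  18 * (`|lambda| * C) <= s `^ alpha * s ->
  0 <= b -> N%:R <= b * `|lambda| ->
  ((N.+1%:R `^ p^-1 / (4 * s))%:E <= A_norm p (fun t => expi (lambda * phi t)))%E.
Proof.
move=> a0 a1 C0 pphi dphi H hb p1 hs b0 hN.
have s0 : 0 < s by rewrite sqrtr_gt0.
have p0 : 0 < p by lra.
have cphi : continuous (fun t => lambda * phi t).
  move=> t; apply: cvgM; first exact: cvg_cst.
  by apply: differentiable_continuous; apply/derivable1_diffP.
pose a k := ComplexField.Normc.normc (fourier_coef (fun t => expi (lambda * phi t)) k).
have nc0 (z : R[i]) : 0 <= ComplexField.Normc.normc z by case: z => x y; exact: sqrtr_ge0.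
have a_ge0 k : 0 <= a k by exact: nc0.
(* For lambda = 0 only j = 0 is available, and phi' t0 = 0 / 0 = 0 serves. *)
pose f (j : nat) : int := if 0 <= lambda then j%:Z else - j%:Z.
have finj : injective f.
  by move=> i j; rewrite /f; case: ifP => _ => [[]|/oppr_inj[]].
have key j : (j < N.+1)%N -> (4 * s)^-1 <= iter n.+1 lattice_avg a (f j).
  rewrite ltnS => jN.
  have [t0 et] : exists t0, derive1 phi t0 = j%:R / `|lambda|.
    apply: hb; rewrite divr_ge0//=.
    have jl : j%:R <= b * `|lambda| by apply: le_trans hN; rewrite ler_nat.
    have [->|l0] := eqVneq lambda 0; first by rewrite normr0 invr0 mulr0.
    by rewrite ler_pdivrMr ?normr_gt0.
  have lk : lambda * derive1 phi t0 = (f j)%:~R.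
    rewrite et /f; have [l0|l0|l0] := ltrgt0P lambda.
    - by rewrite mulrC divfK ?gt_eqF// -pmulrn.
    - by rewrite invrN mulrN mulrN mulrC divfK ?lt_eqF// intrN -pmulrn.
    - rewrite l0 mul0r -pmulrn.
      have : j%:R <= 0 :> R by apply: le_trans (le_trans hN _); rewrite ?ler_nat// l0 normr0 mulr0.
      by rewrite lern0 => /eqP ->.
  have h1 := hump_coef_large alpha C lambda phi t0 (f j) n a0 a1 C0 pphi dphi H lk hs.
  have h2 := le_hump_coef _ a (2 * pi) t0 n.+1 cphi (fun k th => hump_coef0 _ t0 k th cphi)
     (f j) (lambda * phi t0 - (f j)%:~R * t0).
  have := le_trans h1 h2.
  rewrite -/s (_ : 2^-1 * (pi / s) = 2 * pi * (4 * s)^-1); last first.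
    by field; rewrite gt_eqF.
  by rewrite ler_pM2l// mulr_gt0 ?pi_gt0.
have i0 : 0 <= (4 * s)^-1 by rewrite invr_ge0 mulr_ge0// ltW.
have sum_ge : ((N.+1%:R * (4 * s)^-1 `^ p)%:E <= \esum_(k in [set: int]) (a k `^ p)%:E)%E.
  apply: le_trans (esum_powR_iter_lattice_avg p a n.+1 p1 a_ge0).
  apply: (esum_ge_injective (fun k => iter n.+1 lattice_avg a k `^ p) f).
  - exact: powR_ge0.
  - exact: finj.
  - move=> j jN; rewrite ge0_ler_powR ?nnegrE ?(ltW p0)//; last exact: key.
    exact: iter_lattice_avg_ge0.
rewrite /A_norm.
apply: (@le_trans _ _ ((N.+1%:R * (4 * s)^-1 `^ p)%:E `^ p^-1)%E).
  rewrite poweR_EFin lee_fin powRM ?powR_ge0// -powRrM divff ?gt_eqF//.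
  by rewrite powRr1.
apply: gt0_ler_poweR => //; rewrite ?invr_ge0 ?(ltW p0)//.
- by rewrite in_itv/= leey lee_fin mulr_ge0 ?powR_ge0.
- by rewrite in_itv/= leey andbT esum_ge0// => k _; rewrite lee_fin powR_ge0.
Qed.

Lemma sqrt_between {R : realType} (X : R) : 0 <= X ->
  exists n : nat, X <= Num.sqrt n.+1%:R <= X + 1.
Proof.
move=> X0; exists (Num.truncn (X ^+ 2)).
have := truncn_itv (sqr_ge0 X); set n := Num.truncn _ => /andP[h1 h2].
apply/andP; split.
  by rewrite -[X]ger0_norm// -sqrtr_sqr ler_sqrt// ltW.
rewrite -[X + 1]ger0_norm ?addr_ge0// -sqrtr_sqr ler_sqrt ?sqr_ge0//.
by rewrite -natr1; nra.
Qed.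

Lemma A_norm_power_lower {R : realType} (alpha : R) (phi : R -> R) :
  0 < alpha -> alpha <= 1 -> C1_alpha alpha phi -> (exists s t : R, phi s <> phi t) ->
  forall p, 1 <= p -> p < 1 + alpha ->
  exists2 c : R, 0 < c & forall lambda : R,
    ((c * `|lambda| `^ (p^-1 - (1 + alpha)^-1))%:E
       <= A_norm p (fun t => expi (lambda * phi t)))%E.
Proof.
move=> a0 a1 [pphi dphi hphi] nc p p1 pa.
have cphi' := hoelder_continuous _ _ a0 hphi.
have [C C0 HC] := hoelder_pi _ _ a0 hphi.
have [b b0 hb] := derive1_range phi pphi dphi cphi' nc.
have p0 : 0 < p by lra.
pose q := (1 + alpha)^-1.
have q0 : 0 < q by rewrite invr_gt0; lra.
have qp : q < p^-1 by rewrite ltf_pV2 ?posrE//; lra.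
pose m := Num.min 1 b.
have m0 : 0 < m by rewrite lt_min ltr01 b0.
pose K := (18 * C) `^ q + 1.
have K0 : 0 < K by have := powR_ge0 (18 * C) q; rewrite /K; lra.
exists (m `^ p^-1 / (4 * K)).
  by rewrite divr_gt0 ?powR_gt0 ?mulr_gt0.
move=> lambda.
(* Replacing |lambda| by L treats small lambda, where the hump keeps a bounded
   width and the frequency 0 alone suffices, together with large lambda. *)
pose L := Num.max 1 `|lambda|.
have L1 : 1 <= L by rewrite le_max lexx.
have lL : `|lambda| <= L by rewrite le_max lexx orbT.
have L0 : 0 < L by lra.
have Lq : 0 < L `^ q by rewrite powR_gt0.
have Lq1 : 1 <= L `^ q.
  by have := @ge0_ler_powR _ _ (ltW q0) 1 L; rewrite !nnegrE powR1; apply => //; exact: ltW.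
have CL0 : 0 <= 18 * C * L by rewrite !mulr_ge0// ltW.
(* The width 1 / s is of the order L^(-1/(1+alpha)), the largest for which the
   phase error stays small. *)
have [n /andP[n1 n2]] := sqrt_between ((18 * C * L) `^ q) (powR_ge0 _ _).
set s := Num.sqrt _ in n1 n2.
have s0 : 0 < s by rewrite sqrtr_gt0.
have hs : 18 * (`|lambda| * C) <= s `^ alpha * s.
  apply: (@le_trans _ _ (18 * C * L)).
    by rewrite -mulrA ler_wpM2l// mulrC ler_wpM2l.
  have -> : s `^ alpha * s = s `^ (1 + alpha).
    by rewrite powRD ?(gt_eqF s0) ?implybT// powRr1 ?(ltW s0)// mulrC.
  have -> : 18 * C * L = ((18 * C * L) `^ q) `^ (1 + alpha).
    by rewrite -powRrM mulVf ?powRr1// gt_eqF//; lra.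
  by rewrite ge0_ler_powR ?nnegrE ?powR_ge0 ?(ltW s0)//; lra.
have sK : s <= K * L `^ q.
  by apply: le_trans n2 _; rewrite powRM ?mulr_ge0 ?(ltW L0)// /K; lra.
have bl0 : 0 <= b * `|lambda| by rewrite mulr_ge0// ltW.
have := truncn_itv bl0; set N := Num.truncn _ => /andP[N1 N2].
have hA := A_norm_lower alpha C b p lambda phi n N a0 a1 C0 pphi dphi HC hb p1 hs (ltW b0) N1.
apply: le_trans hA; rewrite lee_fin -/s.
have mN : m * L <= N.+1%:R.
  rewrite /L; case: (leP 1 `|lambda|) => hl.
    apply: le_trans (ltW N2); rewrite ler_wpM2r// /m ge_min lexx orbT //.
  rewrite mulr1 (@le_trans _ _ 1) ?ler1n// /m ge_min lexx //.
apply: (@le_trans _ _ (m `^ p^-1 / (4 * K) * L `^ (p^-1 - q))).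
  rewrite ler_wpM2l ?divr_ge0 ?powR_ge0 ?mulr_ge0 ?(ltW K0)//.
  by rewrite ge0_ler_powR ?nnegrE ?(ltW L0)// subr_ge0 ltW.
rewrite powRB ?(gt_eqF L0) ?implybT//.
rewrite (_ : _ * _ = (m * L) `^ p^-1 / (4 * (K * L `^ q))); last first.
  rewrite powRM ?(ltW m0) ?(ltW L0)//; field.
  by rewrite !gt_eqF.
apply: ler_pM; rewrite ?powR_ge0 ?invr_ge0 ?mulr_ge0 ?(ltW K0) ?(ltW Lq)//.
  by rewrite ge0_ler_powR ?nnegrE ?mulr_ge0 ?(ltW m0) ?(ltW L0) ?invr_ge0 ?(ltW p0).
by rewrite lef_pV2 ?posrE ?mulr_gt0// ler_wpM2l.
Qed.

Theorem corollary1 (R : realType) (alpha : R) (phi : R -> R) :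
  0 < alpha -> alpha <= 1 ->
  C1_alpha alpha phi ->
  (exists s t : R, phi s <> phi t) ->
  (forall p : R, 1 <= p -> p < 1 + alpha ->
     exists2 c : R, 0 < c &
       forall lambda : R,
         ((c * `|lambda| `^ (p^-1 - (1 + alpha)^-1))%:E
            <= A_norm p (fun t => expi (lambda * phi t)))%E) /\
  (exists2 c : R, 0 < c &
     forall lambda : R,
       ((c * `|lambda| `^ (alpha / (1 + alpha)))%:E
          <= A_norm 1 (fun t => expi (lambda * phi t)))%E).
Proof.
move=> a0 a1 hphi nc.
have main := A_norm_power_lower alpha phi a0 a1 hphi nc.
split => //.
have [||c c0 hc] := main 1; [exact: lexx|by lra|].
exists c => // lambda; have := hc lambda.
suff -> : 1^-1 - (1 + alpha)^-1 = alpha / (1 + alpha) by [].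
by field; apply/eqP; lra.
Qed.
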